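(* For every positive integer $n$, $$16\sum_{m<n}\widetilde{\sigma}(m)\widetilde{\sigma}_3(n-m)=-\widetilde{\sigma}_5(n)+2(n-1)\widetilde{\sigma}_3(n)+\widetilde{\sigma}(n),$$ where the sum runs over positive integers $m<n$.
   Context: For $s,n\in\mathbb{N}$ (positive integers), $\widetilde{\sigma}_s(n)=\sum_{d\mid n}(-1)^{d-1}d^s$; write $\widetilde{\sigma}=\widetilde{\sigma}_1$. *)

(* Defs.v *)
From mathcomp Require Import all_boot all_order all_algebra.

Set Implicit Arguments.
Unset Strict Implicit.
Unset Printing Implicit Defensive.

Import GRing.Theory.
Local Open Scope ring_scope.

(* Since [divisors 0 = [::]], [sigma_alt s 0 = 0]; only n > 0 is meaningful.
   The exponent [d.-1] is a genuine d - 1, every divisor listed being >= 1. *)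
Definition sigma_alt (s n : nat) : int :=
  \sum_(d <- divisors n) (-1) ^+ d.-1 * d%:Z ^+ s.

(* Main.v *)
Require Import Defs.
From mathcomp Require Import all_boot all_order all_algebra.
From mathcomp Require Import zify ring.

(** Expanding both divisor sums turns the convolution into a sum over the
    representations n = a x + b y in positive integers, with summand
    (-1)^(a+b) a b^3.  Such sums are governed by Liouville's identity
    [liouville_identity]: for an even function F, the sum of
    F(a - b) - F(a + b) over all representations of n reduces to sums over the
    divisors of n.  For F(k) = (-1)^k k^4 the difference F(a - b) - F(a + b)
    equals -8 (-1)^(a+b) (a^3 b + a b^3), so by the symmetry (a, x) <-> (b, y)
    that sum is -16 times the convolution, while among the divisor sums the
    inner sums of (-1)^l l^4 have the closed form [sum_alt_pow4].

    Liouville's identity itself comes from one bijection (Euclid's subtraction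
    step), a x + b y = a (x - y) + (a + b) y, which matches the representations
    with y < x to those whose first coefficient is smaller than the second
    ([sum_reps_shear]).  It shows that the part a < b of the sum of F(a - b) is
    the part y < x of the sum of F(b), call it X, and that the part y < x of
    the sum of F(a + b) is the part a < b of the sum of F(b), call it Y.  The
    opposite parts agree with these by symmetry, so only the diagonals a = b
    and x = y, and 2 (X - Y), remain.  Splitting the sum of F(b) along a and b
    on the one hand, along x and y on the other, and applying the bijection a
    third time expresses X - Y by diagonals as well.  Diagonals are sums over
    divisors: a (x + y) = n, respectively (a + b) x = n. *)

Set Implicit Arguments.
Unset Strict Implicit.
Unset Printing Implicit Defensive.

Import GRing.Theory.
Local Open Scope ring_scope.

(** * Reindexing sums over duplicate-free sequences *)

Lemma big_seq_reindex (R : Type) (idx : R) (op : Monoid.com_law idx)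
    (I J : eqType) (r : seq I) (s : seq J) (P : pred I) (Q : pred J)
    (f : I -> J) (g : J -> I) (F : J -> R) :
  uniq r -> uniq s ->
  {in r, forall i, P i -> [/\ f i \in s, Q (f i) & g (f i) = i]} ->
  {in s, forall j, Q j -> [/\ g j \in r, P (g j) & f (g j) = j]} ->
  \big[op/idx]_(j <- s | Q j) F j = \big[op/idx]_(i <- r | P i) F (f i).
Proof.
move=> r_uniq s_uniq fP gP.
rewrite -big_filter -[RHS]big_filter -(big_map f predT); apply: perm_big.
apply: uniq_perm; first exact: filter_uniq.
  rewrite map_inj_in_uniq ?filter_uniq // => i i'.
  rewrite !mem_filter => /andP[Pi ri] /andP[Pi' ri'] eq_f.
  by have [_ _ <-] := fP i ri Pi; have [_ _ <-] := fP i' ri' Pi'; rewrite eq_f.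
move=> j; apply/idP/mapP => [|[i]]; rewrite mem_filter => /andP[].
  by move=> Qj sj; have [rg Pg fg] := gP j sj Qj; exists (g j); rewrite ?mem_filter ?Pg.
by move=> Pi ri ->; have [sf Qf _] := fP i ri Pi; rewrite mem_filter Qf.
Qed.

Lemma big_trichotomy (R : Type) (idx : R) (op : Monoid.com_law idx)
    (I : Type) (r : seq I) (f g : I -> nat) (F : I -> R) :
  \big[op/idx]_(i <- r) F i =
  op (\big[op/idx]_(i <- r | f i == g i) F i)
     (op (\big[op/idx]_(i <- r | (f i < g i)%N) F i)
         (\big[op/idx]_(i <- r | (g i < f i)%N) F i)).
Proof.
rewrite (bigID (fun i => f i == g i)) /=; congr (op _ _).
rewrite (bigID (fun i => f i < g i)%N) /=.
by congr (op _ _); apply: eq_bigl => i; lia.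
Qed.

(** * Representations n = a x + b y *)

(** The pair [((a, x), (b, y))] stands for the representation
    n = a x + b y in positive integers.  Listing first the value m = a x, then
    a divisor of each of m and n - m, makes sums over this sequence unfold
    into convolutions of divisor sums. *)
Definition reps (n : nat) : seq ((nat * nat) * (nat * nat)) :=
  [seq ((p.1, m %/ p.1)%N, (p.2, (n - m) %/ p.2)%N)
     | m <- index_iota 1 n,
       p <- [seq (a, b) | a <- divisors m, b <- divisors (n - m)%N]].

Lemma mem_reps n a x b y :
  (((a, x), (b, y)) \in reps n) =
  [&& 0 < a, 0 < x, 0 < b, 0 < y & a * x + b * y == n]%N.
Proof.
apply/allpairsPdep/idP => [[m [[a' b'] []]]|/and5P[a0 x0 b0 y0 /eqP <-]].
  rewrite mem_index_iota => /andP[m0 mn] /allpairsP[[c d] /= []].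
  have nm0 : (0 < n - m)%N by rewrite subn_gt0.
  rewrite -!dvdn_divisors // => am bn [-> ->] /=.
  case=> -> -> -> ->.
  have m_div : (c * (m %/ c) = m)%N by rewrite mulnC divnK.
  have n_div : (d * ((n - m) %/ d) = n - m)%N by rewrite mulnC divnK.
  lia.
have ax0 : (0 < a * x)%N by rewrite muln_gt0 a0.
have bY0 : (0 < b * y)%N by rewrite muln_gt0 b0.
exists (a * x)%N, (a, b); rewrite mem_index_iota ax0 -ltn_subLR ?subnn //=.
split=> //; last by rewrite addKn !mulKn.
by apply/allpairsP; exists (a, b); rewrite /= addKn -!dvdn_divisors // !dvdn_mulr.
Qed.

Lemma reps_uniq n : uniq (reps n).
Proof.
apply: allpairs_uniq_dep => [|m _|]; first exact: iota_uniq.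
  by apply: allpairs_uniq; rewrite ?divisors_uniq // => -[a b] [c d] _ _ [-> ->].
(* The value m = a x is recovered from the pair (a, x). *)
have tagE q : q \in [seq Tagged (i := m) (fun=> (nat * nat)%type) p
    | m <- index_iota 1 n,
      p <- [seq (a, b) | a <- divisors m, b <- divisors (n - m)%N]] ->
    tag q = ((tagged q).1 * (tag q %/ (tagged q).1))%N.
  move=> /allpairsPdep[m [p [m_in p_in ->]]] /=.
  move: m_in; rewrite mem_index_iota => /andP[m_gt0 _].
  case/allpairsP: p_in => -[a b] /= [am _ ->] /=.
  by rewrite mulnC divnK // dvdn_divisors.
move=> [m [a b]] [m' [c d]] /tagE /= mE /tagE /= mE' [eac em ebd _].
by have -> : m = m'; rewrite ?eac ?ebd // mE em eac -mE'.
Qed.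

Lemma sum_reps_swap (V : nmodType) n (P : pred ((nat * nat) * (nat * nat)))
    (G : (nat * nat) * (nat * nat) -> V) :
  \sum_(q <- reps n | P q) G q = \sum_(q <- reps n | P (q.2, q.1)) G (q.2, q.1).
Proof.
pose swap (q : (nat * nat) * (nat * nat)) := (q.2, q.1).
apply: (big_seq_reindex (f := swap) (g := swap) _ _); rewrite ?reps_uniq //.
all: move=> [[a x] [b y]]; rewrite /swap mem_reps /= => + Pq; split=> //.
all: by rewrite mem_reps; lia.
Qed.

(** Euclid's subtraction step a x + b y = a (x - y) + (a + b) y is a bijection
    from the representations with y < x onto those with the first coefficient
    less than the second; subtracting the coefficients undoes it. *)
Lemma sum_reps_shear (V : nmodType) n (G : nat -> nat -> V) :
  \sum_(q <- reps n | (q.1.1 < q.2.1)%N) G q.1.1 q.2.1 =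
  \sum_(q <- reps n | (q.2.2 < q.1.2)%N) G q.1.1 (q.1.1 + q.2.1)%N.
Proof.
pose f (q : (nat * nat) * (nat * nat)) :=
  ((q.1.1, q.1.2 - q.2.2)%N, (q.1.1 + q.2.1, q.2.2)%N).
pose g (q : (nat * nat) * (nat * nat)) :=
  ((q.1.1, q.1.2 + q.2.2)%N, (q.2.1 - q.1.1, q.2.2)%N).
apply: (big_seq_reindex (f := f) (g := g) _ _); rewrite ?reps_uniq //.
all: move=> [[a x] [b y]]; rewrite mem_reps /f /g /= => /and5P[a0 x0 b0 y0 n_eq] lt.
all: rewrite mem_reps.
  by split; [nia | lia | congr (_, _, (_, _)); lia].
by split; [nia | lia | congr (_, _, (_, _)); lia].
Qed.

Definition divisor_pairs (n : nat) (h : nat -> nat) : seq (nat * nat) :=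
  [seq (d, l) | d <- divisors n, l <- index_iota 1 (h d)].

Lemma mem_divisor_pairs n h d l : (0 < n)%N ->
  ((d, l) \in divisor_pairs n h) = [&& d %| n, 0 < l & l < h d]%N.
Proof.
move=> n_gt0; apply/allpairsPdep/idP => [[d' [l' [+ + [-> ->]]]]|/andP[dn lP]].
  by rewrite -dvdn_divisors // mem_index_iota => -> ->.
by exists d, l; rewrite -dvdn_divisors // mem_index_iota.
Qed.

Lemma divisor_pairs_uniq n h : uniq (divisor_pairs n h).
Proof.
apply: allpairs_uniq_dep => [|d _|]; first exact: divisors_uniq.
  exact: iota_uniq.
by move=> [d l] [d' l'] _ _ /= [-> ->].
Qed.

(** A representation with a = b is a divisor a of n together with a splitting
    of n / a as x + y, for which there are n / a - 1 choices. *)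
Lemma sum_reps_eq_coef (V : nmodType) n (G : nat -> nat -> V) : (0 < n)%N ->
  \sum_(q <- reps n | q.1.1 == q.2.1) G q.1.1 q.2.1 =
  \sum_(d <- divisors n) G d d *+ (n %/ d).-1.
Proof.
move=> n_gt0.
pose f (p : nat * nat) := ((p.1, p.2), (p.1, n %/ p.1 - p.2)%N).
pose g (q : (nat * nat) * (nat * nat)) := q.1.
rewrite (big_seq_reindex (r := divisor_pairs n (divn n)) (P := predT) (f := f)
  (g := g) _ _) ?reps_uniq ?divisor_pairs_uniq //.
- rewrite /f big_allpairs_dep; apply: eq_bigr => d _ /=.
  by rewrite big_const_nat iter_addr_0 subn1.
- move=> [d l]; rewrite mem_divisor_pairs // => /and3P[dn l0 ln] _.
  rewrite /f /g /= mem_reps eqxx; split=> //.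
  have d_gt0 := dvdn_gt0 n_gt0 dn.
  rewrite d_gt0 l0 subn_gt0 ln -mulnDr subnKC ?(ltnW ln) //=.
  by rewrite mulnC divnK.
- move=> [[a x] [b y]]; rewrite mem_reps => /and5P[a0 x0 b0 y0 /eqP n_eq] /= /eqP eab.
  subst b; rewrite -mulnDr in n_eq.
  have qE : (n %/ a = x + y)%N by rewrite -n_eq mulKn.
  by rewrite mem_divisor_pairs // /f /g /= qE addKn -n_eq dvdn_mulr //; split=> //; lia.
Qed.

(** A representation with x = y is a divisor a + b of n together with the
    splitting of that divisor. *)
Lemma sum_reps_eq_cofactor (V : nmodType) n (G : nat -> nat -> V) : (0 < n)%N ->
  \sum_(q <- reps n | q.1.2 == q.2.2) G q.1.1 q.2.1 =
  \sum_(d <- divisors n) \sum_(1 <= l < d) G l (d - l)%N.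
Proof.
move=> n_gt0.
pose f (p : nat * nat) := ((p.2, n %/ p.1)%N, (p.1 - p.2, n %/ p.1)%N).
pose g (q : (nat * nat) * (nat * nat)) := ((q.1.1 + q.2.1)%N, q.1.1).
rewrite (big_seq_reindex (r := divisor_pairs n id) (P := predT) (f := f)
  (g := g) _ _) ?reps_uniq ?divisor_pairs_uniq //.
- by rewrite /f big_allpairs_dep; apply: eq_bigr => d _.
- move=> [d l]; rewrite mem_divisor_pairs // => /and3P[dn l0 ln] _.
  rewrite /f /g /= mem_reps eqxx subnKC ?(ltnW ln) //; split=> //.
  have d_gt0 := dvdn_gt0 n_gt0 dn.
  rewrite l0 subn_gt0 ln divn_gt0 // (dvdn_leq n_gt0 dn) -mulnDl subnKC ?(ltnW ln) //=.
  by rewrite mulnC divnK.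
- move=> [[a x] [b y]]; rewrite mem_reps => /and5P[a0 x0 b0 y0 /eqP n_eq] /= /eqP exy.
  subst y; rewrite -mulnDl in n_eq.
  have qE : (n %/ (a + b) = x)%N by rewrite -n_eq mulKn // addn_gt0 a0.
  by rewrite mem_divisor_pairs // /f /g /= qE addKn -n_eq dvdn_mulr //; split=> //; lia.
Qed.

(** * Liouville's identity *)

(** The sum of F(a - b) is its diagonal a = b plus 2 X, and the sum of F(a + b)
    is its diagonal x = y plus 2 Y, so what remains to compute is X - Y.  Write
    D and E for the diagonals a = b and x = y of the sum of F(b).  The part
    b < a of that sum equals its part x < y, and cancelling it from the two
    splittings leaves X - Y = D - E. *)
Theorem liouville_identity (V : zmodType) (F : int -> V) (n : nat) : (0 < n)%N ->
  (forall k, F (- k) = F k) ->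
  \sum_(q <- reps n) (F (q.1.1%:Z - q.2.1%:Z) - F (q.1.1%:Z + q.2.1%:Z)) =
  \sum_(d <- divisors n)
    (F 0 *+ (n %/ d).-1 - F d%:Z *+ d.-1
     + (F d%:Z *+ (n %/ d).-1 - \sum_(1 <= l < d) F l%:Z) *+ 2).
Proof.
move=> n_gt0 F_even; rewrite sumrB.
pose Fb (q : (nat * nat) * (nat * nat)) := F q.2.1%:Z.
pose X := \sum_(q <- reps n | (q.2.2 < q.1.2)%N) Fb q.
pose Y := \sum_(q <- reps n | (q.1.1 < q.2.1)%N) Fb q.
pose D := \sum_(q <- reps n | q.1.1 == q.2.1) Fb q.
pose E := \sum_(q <- reps n | q.1.2 == q.2.2) Fb q.
have diffE : \sum_(q <- reps n) F (q.1.1%:Z - q.2.1%:Z) =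
    \sum_(d <- divisors n) F 0 *+ (n %/ d).-1 + (X + X).
  pose G a b := F (a%:Z - b%:Z).
  have ltE : \sum_(q <- reps n | (q.1.1 < q.2.1)%N) G q.1.1 q.2.1 = X.
    rewrite sum_reps_shear; apply: eq_bigr => q _.
    by rewrite /G PoszD opprD addNKr F_even.
  rewrite (big_trichotomy _ _ (fun q => q.1.1) (fun q => q.2.1)); congr (_ + (_ + _)) => //.
    rewrite (sum_reps_eq_coef G) //; apply: eq_bigr => d _.
    by rewrite /G subrr.
  rewrite sum_reps_swap -ltE; apply: eq_bigr => q _.
  by rewrite /G -F_even opprB.
have sumE : \sum_(q <- reps n) F (q.1.1%:Z + q.2.1%:Z) =
    \sum_(d <- divisors n) F d%:Z *+ d.-1 + (Y + Y).
  pose G a b := F (a%:Z + b%:Z).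
  have gtE : \sum_(q <- reps n | (q.2.2 < q.1.2)%N) G q.1.1 q.2.1 = Y.
    by rewrite /Y (sum_reps_shear n (fun _ b => F b%:Z)).
  rewrite (big_trichotomy _ _ (fun q => q.1.2) (fun q => q.2.2)); congr (_ + (_ + _)) => //.
    rewrite (sum_reps_eq_cofactor G) //; apply: eq_bigr => d _.
    transitivity (\sum_(1 <= l < d) F d%:Z).
      apply: eq_big_nat => l /andP[_ ld].
      by rewrite /G -PoszD subnKC // ltnW.
    by rewrite big_const_nat iter_addr_0 subn1.
  rewrite sum_reps_swap -gtE; apply: eq_bigr => q _.
  by rewrite /G addrC.
have XY : E + X = D + Y.
  have ltE : \sum_(q <- reps n | (q.1.2 < q.2.2)%N) Fb q
            = \sum_(q <- reps n | (q.2.1 < q.1.1)%N) Fb q.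
    rewrite sum_reps_swap [RHS]sum_reps_swap.
    exact: esym (sum_reps_shear n (fun a _ => F a%:Z)).
  (* Compare the two splittings of the full sum of F(b). *)
  have := big_trichotomy +%R (reps n) (fun q => q.1.1) (fun q => q.2.1) Fb.
  rewrite (big_trichotomy +%R (reps n) (fun q => q.1.2) (fun q => q.2.2) Fb).
  by rewrite /= ltE (addrC _ X) !addrA => /addIr.
have DE : D - E = \sum_(d <- divisors n)
    (F d%:Z *+ (n %/ d).-1 - \sum_(1 <= l < d) F l%:Z).
  rewrite sumrB /D (sum_reps_eq_coef (fun _ b => F b%:Z)) //.
  rewrite /E sum_reps_swap (eq_bigl _ _ (fun q => eq_sym q.2.2 q.1.2)).
  by rewrite (sum_reps_eq_cofactor (fun a _ => F a%:Z)).
have {XY} XY : X = Y + (D - E) by rewrite addrA (addrC Y) -XY addrAC subrr add0r.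
rewrite diffE sumE big_split /= sumrB sumrMnl -DE XY.
rewrite opprD addrACA; congr (_ + _).
by rewrite (addrACA Y) addrAC subrr add0r mulr2n.
Qed.

(** * The convolution *)

(** The signs (-1)^(a-1) and (-1)^(b-1) multiply to (-1)^(a+b). *)
Lemma sum_reps_sigma_alt n s t :
  \sum_(1 <= m < n) sigma_alt s m * sigma_alt t (n - m)%N =
  \sum_(q <- reps n)
     (-1) ^+ (q.1.1 + q.2.1) * (q.1.1%:Z ^+ s * q.2.1%:Z ^+ t).
Proof.
rewrite big_allpairs_dep; apply: eq_big_nat => m /andP[m_gt0 m_lt].
rewrite big_allpairs big_distrlr /=.
rewrite [LHS]big_seq_cond [RHS]big_seq_cond; apply: eq_bigr => a /andP[am _].
rewrite [LHS]big_seq_cond [RHS]big_seq_cond; apply: eq_bigr => b /andP[bnm _].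
have nm_gt0 : (0 < n - m)%N by rewrite subn_gt0.
move: am bnm; rewrite -!dvdn_divisors // => /(dvdn_gt0 m_gt0) + /(dvdn_gt0 nm_gt0).
case: a b => [|a] [|b] //= _ _.
by rewrite mulrACA -exprD addSn addnS !exprS !mulN1r opprK.
Qed.

Lemma sum_alt_pow4 d : (0 < d)%N ->
  (\sum_(1 <= l < d) (-1) ^+ l * l%:Z ^+ 4) *+ 2 =
  (-1) ^+ d.-1 * (d%:Z ^+ 4 - 2 * d%:Z ^+ 3 + d%:Z).
Proof.
case: d => // d _; elim: d => [|d IHd]; first by rewrite big_nil.
rewrite big_nat_recr //= mulrnDl IHd /= (exprS _ d).
have -> : d.+2%:Z = d%:Z + 2 by lia.
have -> : d.+1%:Z = d%:Z + 1 by lia.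
ring.
Qed.

Theorem theorem4p3 (n : nat) (n_gt0 : (0 < n)%N) :
  16 * (\sum_(1 <= m < n) sigma_alt 1 m * sigma_alt 3 (n - m)%N) =
  - sigma_alt 5 n + 2 * (n%:Z - 1) * sigma_alt 3 n + sigma_alt 1 n.
Proof.
pose F (k : int) := (-1) ^+ `|k|%N * k ^+ 4 : int.
have F_even k : F (- k) = F k by rewrite /F abszN; congr (_ * _); ring.
pose S := \sum_(q <- reps n)
  (-1) ^+ (q.1.1 + q.2.1) * (q.1.1%:Z ^+ 1 * q.2.1%:Z ^+ 3) : int.
have S_swap : S = \sum_(q <- reps n)
    (-1) ^+ (q.1.1 + q.2.1) * (q.1.1%:Z ^+ 3 * q.2.1%:Z ^+ 1).
  rewrite /S sum_reps_swap; apply: eq_bigr => q _ /=.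
  by rewrite addnC [X in _ * X]mulrC.
have lhsE : \sum_(q <- reps n) (F (q.1.1%:Z - q.2.1%:Z) - F (q.1.1%:Z + q.2.1%:Z))
    = - (16 * S).
  (* Half of the terms a b^3 are replaced by their mirror images a^3 b. *)
  have -> : 16 * S = 8 * S + 8 * S by rewrite -mulrDl.
  rewrite {2}S_swap !mulr_sumr -big_split -sumrN; apply: eq_bigr => q _ /=.
  rewrite /F.
  have -> : (-1) ^+ `|q.1.1%:Z - q.2.1%:Z|%N = (-1) ^+ (q.1.1 + q.2.1) :> int.
    rewrite -signr_odd -[RHS]signr_odd; congr (_ ^+ nat_of_bool _); lia.
  rewrite -PoszD absz_nat PoszD.
  ring.
(* Both sides are now sums over the divisors d of n, compared term by term. *)
rewrite sum_reps_sigma_alt -/S; apply: oppr_inj; rewrite -lhsE.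
rewrite (liouville_identity n_gt0 F_even) /sigma_alt -sumrN !mulr_sumr -!big_split -sumrN.
rewrite [LHS]big_seq_cond [RHS]big_seq_cond; apply: eq_bigr => d /andP[dn _] /=.
move: dn; rewrite -dvdn_divisors // => dn; have d_gt0 := dvdn_gt0 n_gt0 dn.
rewrite mulrnBl (eq_bigr (fun l => (-1) ^+ l * l%:Z ^+ 4)) // sum_alt_pow4 //.
rewrite (_ : n%:Z = d%:Z * (n %/ d)%:Z); last by rewrite -PoszM mulnC divnK.
have : (0 < n %/ d)%N by rewrite divn_gt0 // dvdn_leq.
rewrite /F /= expr0n /= mulr0 mul0rn sub0r.
case: (n %/ d)%N => // k _; case: d {dn} d_gt0 => //= d _.
rewrite exprS -(mulr_natr _ d) -(mulr_natr _ k) !natz.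
have -> : k.+1%:Z = k%:Z + 1 by lia.
have -> : d.+1%:Z = d%:Z + 1 by lia.
ring.
Qed.
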